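(* Let $\mathcal{S}\subset\mathbb{R}^d$ be a set of sampled signals, let $\mathcal{T}=\{(\boldsymbol{s}_i,\alpha_i)\}_{i=1,\dots,n}$ be a training set of sampled signals and corresponding frequency parameters, and let $F_\theta:\mathcal{S}\subset\mathbb{R}^d\to\mathbb{R}$ be a neural network, trained using $\mathcal{T}$, whose output $\alpha:=F_\theta(\boldsymbol{s})$ is used as the HP-spline frequency parameter for $\boldsymbol{s}$, under the regularity assumptions (A1)–(A3) listed in the context. Let $s_\alpha(\cdot,\alpha)$ be the composite function, acting both on the sampled signal and on the frequency parameter, which estimates the HP-spline coefficients in $\mathbb{R}^{m+2}$ from $(\boldsymbol{s},F_\theta(\boldsymbol{s}))$. Assume that $F_\theta$ is $L_F$-Lipschitz, i.e. $$\|F_\theta(\boldsymbol{s})-F_\theta(\boldsymbol{s}')\|\le L_F\|\boldsymbol{s}-\boldsymbol{s}'\|,\qquad \boldsymbol{s},\boldsymbol{s}'\in\mathcal{S},$$ and that the composite model satisfies the two Lipschitz conditions $$\|s_\alpha(\boldsymbol{s},\alpha)-s_\alpha(\boldsymbol{s}',\alpha)\|\le L_{\boldsymbol{s}}\|\boldsymbol{s}-\boldsymbol{s}'\|,\qquad \boldsymbol{s},\boldsymbol{s}'\in\mathcal{S},$$ $$\|s_\alpha(\boldsymbol{s},\alpha)-s_{\alpha'}(\boldsymbol{s},\alpha')\|\le L_\alpha\|\alpha-\alpha'\|,\qquad \alpha,\alpha'\in\mathbb{R}.$$ Then, for all $\boldsymbol{s},\boldsymbol{s}'\in\mathcal{S}$,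 with $\alpha=F_\theta(\boldsymbol{s})$ and $\alpha'=F_\theta(\boldsymbol{s}')$, $$\|s_\alpha(\boldsymbol{s},\alpha)-s_{\alpha'}(\boldsymbol{s}',\alpha')\|\le (L_{\boldsymbol{s}}+L_\alpha L_F)\,D,$$ where $D=\sup_{\boldsymbol{s},\boldsymbol{s}'\in\mathcal{S}}\|\boldsymbol{s}-\boldsymbol{s}'\|$ is the diameter of the input space $\mathcal{S}$.
   Context: Sampled signals: a real-valued function $s(t)$ sampled at $t_1,\dots,t_d$ gives $\boldsymbol{s}=(s(t_1),\dots,s(t_d))\in\mathcal{S}\subset\mathbb{R}^d$. $\|\cdot\|$ denotes a norm on the relevant finite-dimensional space (absolute value on $\mathbb{R}$). Hyperbolic B-splines: given uniform knots $\xi_1,\dots,\xi_m$ with step $h$ and $\alpha\in\mathbb{R}$, the basis $\{B_j^\alpha\}_{j=0}^{m+1}$ consists of compactly supported (on five consecutive knots) $C^2$ spline functions with segments in $\mathbb{E}_{4,\alpha}=\mathrm{span}\{e^{\alpha t},te^{\alpha t},e^{-\alpha t},te^{-\alpha t}\}$. HP-spline: given data $(t_i,y_i)_{i=1}^d$ and $\lambda>0$, the HP-spline is $s_{\alpha,\lambda}(t)=\sum_{j=0}^{m+1}a_jB_j^\alpha(t)$, where $(a_0,\dots,a_{m+1})\in\mathbb{R}^{m+2}$ minimizes $$\sum_{i=1}^d\Big(y_i-\sum_{j=0}^{m+1}a_jB_j^\alpha(t_i)\Big)^2+\lambda^2\sum_{j=2}^{m+1}\big(a_j-2e^{-\alpha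 h}a_{j-1}+e^{-2\alpha h}a_{j-2}\big)^2.$$ $s_{hp}(\alpha)$ denotes the HP-spline $s_{\alpha,\lambda}$ fitted to the samples $\boldsymbol{s}$. The composite function $s_\alpha(\boldsymbol{s},\alpha)\in\mathbb{R}^{m+2}$ is the map returning the HP-spline coefficients from the signal sample $\boldsymbol{s}$ and the frequency parameter $\alpha$; the subscript only records the frequency parameter in use. Neural network: a feedforward network with ReLU activation $\sigma(x)=\max(0,x)$ in the hidden units and one linear output unit. Regularity assumptions on the true frequency-parameter function $\alpha:\mathcal{S}\to\mathbb{R}$ and on the HP-splines: (A1) $\alpha\in\mathcal{W}^{k,\infty}(\mathcal{S}\setminus E)$ with $E\subset\mathcal{S}$ a finite set of singular points and $\|\alpha\|_{\mathcal{W}^{k,\infty}}\le1$. (A2) $s_{hp}(\alpha)$ is locally Lipschitz in $\alpha$ with constant $L_{\mathrm{hp},i}$ in each smooth region $\mathcal{R}_i\subset\mathcal{S}\setminus E$, with possibly singular points in a set $E_{\mathrm{hp}}$, and $L_{\mathrm{hp}}=\max_iL_{\mathrm{hp},i}$. (A3) There exist ranges of $\alpha$ in which $\|s_{hp}(\alpha_1)-s_{hp}(\alpha_2)\|_{L^\infty}\le L_{\mathrm{flat}}|\alpha_1-\alpha_2|$ with $L_{\mathrm{flat}}\ll L_{\mathrm{hp}}$.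
   Formalization: For α = 0 the stated span is only {1, t} and no compactly supported C² spline basis with such segments exists; there E_{4,0} is taken to be its usual limit, the cubic polynomials. *)

(* Defs.v *)
From HB Require Import structures.
From mathcomp Require Import all_boot all_order all_algebra.
From mathcomp Require Import all_classical all_reals all_analysis.

Set Implicit Arguments.
Unset Strict Implicit.
Unset Printing Implicit Defensive.

Import Order.TTheory GRing.Theory Num.Theory.
Import numFieldNormedType.Exports.

Local Open Scope classical_set_scope.
Local Open Scope ring_scope.

Definition is_norm (R : realType) (V : lmodType R) (N : V -> R) : Prop :=
  [/\ forall x y, N (x + y) <= N x + N y,
      forall (c : R) x, N (c *: x) = `|c| * N x &
      forall x, N x = 0 -> x = 0].

(* Extended real, so that an unbounded set has diameter +oo. *)
Definition diameter (R : realType) (V : lmodType R) (N : V -> R) (S : set V)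
    : \bar R :=
  ereal_sup [set (N (x.1 - x.2))%:E | x in S `*` S].

Inductive relu_net (R : realType) : nat -> Type :=
| Output n (w : 'cV[R]_n) (b : R) : relu_net R n
| Hidden n p (W : 'M[R]_(n, p)) (b : 'rV[R]_p) (net : relu_net R p) :
    relu_net R n.

Fixpoint net_eval (R : realType) n (net : relu_net R n) : 'rV[R]_n -> R :=
  match net with
  | Output _ w b => fun x => (x *m w) 0 0 + b
  | Hidden _ _ W b net' =>
      fun x => net_eval net' (map_mx (Num.max 0) (x *m W + b))
  end.

(* The sigma-finite structure of a product of two sigma-finite measures is not
   inferred from the library (product_measure1 is claimed there by the
   structure for subprobabilities), whence this copy of product_measure1. *)
Section sigma_finite_product.
Context d1 d2 (T1 : measurableType d1) (T2 : measurableType d2) (R : realType).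
Context (m1 : {sigma_finite_measure set T1 -> \bar R}).
Context (m2 : {sigma_finite_measure set T2 -> \bar R}).

Definition sf_prod : set (T1 * T2) -> \bar R := (m1 \x m2)%E.

HB.instance Definition _ := Measure.on sf_prod.

Let sf_prod_sigma_finite : sigma_finite setT sf_prod.
Proof.
have /sigma_finiteP[F [TF ndF Foo]] := sigma_finiteT m1.
have /sigma_finiteP[G [TG ndG Goo]] := sigma_finiteT m2.
exists (fun n => F n `*` G n).
  rewrite -setXTT TF TG predeqE => -[x y]; split.
    move=> [/= [n _ Fnx] [k _ Gky]]; exists (maxn n k) => //; split.
    - by move: x Fnx; exact/subsetPset/ndF/leq_maxl.
    - by move: y Gky; exact/subsetPset/ndG/leq_maxr.
  by move=> [n _ []/= ? ?]; split; exists n.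
move=> k; have [? ?] := Foo k; have [? ?] := Goo k.
split; first exact: measurableX.
by rewrite /sf_prod product_measure1E// lte_mul_pinfty// ge0_fin_numE.
Qed.

HB.instance Definition _ :=
  Measure_isSigmaFinite.Build _ _ _ sf_prod sf_prod_sigma_finite.

End sigma_finite_product.

(* Lebesgue measure on R^n is the n-fold product of the one-dimensional one.  Its
   carrier R * (R * ... * unit) is identified with 'rV[R]_n through coords. *)
Fixpoint iprod_space (R : realType) (n : nat) : {d & measurableType d} :=
  match n with
  | 0 => existT _ _ (unit : measurableType _)
  | n'.+1 => existT _ _
      ((measurableTypeR R * projT2 (iprod_space R n'))%type : measurableType _)
  end.

Definition dirac_tt (R : realType) : {sigma_finite_measure set unit -> \bar R} :=
  dirac tt.

Definition lebesgue_prod (R : realType) d (X : measurableType d)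
    (mu : {sigma_finite_measure set X -> \bar R}) :
    {sigma_finite_measure set (measurableTypeR R * X)%type -> \bar R} :=
  sf_prod (@lebesgue_measure R) mu.

Fixpoint lebesgue_iprod (R : realType) (n : nat) :
    {sigma_finite_measure set (projT2 (iprod_space R n)) -> \bar R} :=
  match n return
    {sigma_finite_measure set (projT2 (iprod_space R n)) -> \bar R} with
  | 0 => dirac_tt R
  | n'.+1 => lebesgue_prod (lebesgue_iprod R n')
  end.

Fixpoint coords (R : realType) (n : nat) :
    projT2 (iprod_space R n) -> 'rV[R]_n :=
  match n with
  | 0 => fun _ => 0
  | n'.+1 => fun x => row_mx (x.1)%:M (coords x.2) : 'rV[R]_(1 + n')
  end.

(* A multi-index of order k is given by a word of k directions. *)
Definition partial (R : realType) d (w : seq 'I_d) (f : 'rV[R]_d -> R) :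
    'rV[R]_d -> R :=
  foldr (fun i g x => 'D_(delta_mx 0 i) g x) f w.

Definition test_function (R : realType) d (U : set 'rV[R]_d)
    (phi : 'rV[R]_d -> R) : Prop :=
  [/\ forall w x, {for x, continuous (partial w phi)},
      forall w x i, derivable (partial w phi) x (delta_mx 0 i),
      compact (closure [set x | phi x != 0]) &
      closure [set x | phi x != 0] `<=` U].

Definition Linfty_norm (R : realType) d (U : set 'rV[R]_d)
    (f : 'rV[R]_d -> R) : \bar R :=
  'N[lebesgue_iprod R d]_(+oo)[EFin \o ((f \_ U) \o @coords R d)].

(* D lists weak derivatives of f on U up to order k, D [::] being a Borel
   representative of the class of f. *)
Definition weak_derivatives (R : realType) d (k : nat) (U : set 'rV[R]_d)
    (f : 'rV[R]_d -> R) (D : seq 'I_d -> 'rV[R]_d -> R) : Prop :=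
  [/\ forall w, (size w <= k)%N -> measurable_fun setT (D w \o @coords R d),
      {ae lebesgue_iprod R d,
        forall x, U (coords x) -> D [::] (coords x) = f (coords x)},
      forall w, (size w <= k)%N -> (Linfty_norm U (D w) < +oo)%E &
      forall w, (size w <= k)%N -> forall phi, test_function U phi ->
        \int[lebesgue_iprod R d]_(x in @coords R d @^-1` U)
           (D [::] (coords x) * partial w phi (coords x)) =
        (-1) ^+ size w *
        \int[lebesgue_iprod R d]_(x in @coords R d @^-1` U)
           (D w (coords x) * phi (coords x))].

Definition sobolev_Winfty (R : realType) d (k : nat) (U : set 'rV[R]_d)
    (f : 'rV[R]_d -> R) : Prop :=
  exists D, weak_derivatives k U f D.

(* Weak derivatives are unique almost everywhere on an open U, so the infimum
   is over equal values. *)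
Definition sobolev_norm (R : realType) d (k : nat) (U : set 'rV[R]_d)
    (f : 'rV[R]_d -> R) : \bar R :=
  ereal_inf [set ereal_sup [set Linfty_norm U (D w) | w in [set w | (size w <= k)%N]]
            | D in weak_derivatives k U f].

(* Knots are indexed by integers: the supports of the first and last basis
   functions need knots outside xi_1, ..., xi_m. *)
Definition knot (R : realType) (xi1 h : R) (j : int) : R := xi1 + (j - 1)%:~R * h.

(* For a = 0 the four spanning functions collapse to 1 and t; the
   four-dimensional space is then ker (D^2 - a^2)^2, the cubic polynomials. *)
Definition exp_segment (R : realType) (a : R) (f : R -> R) : Prop :=
  exists c0 c1 c2 c3 : R, forall t, f t =
    if a == 0 then c0 + c1 * t + c2 * t ^+ 2 + c3 * t ^+ 3
    else c0 * expR (a * t) + c1 * (t * expR (a * t)) +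
         c2 * expR (- a * t) + c3 * (t * expR (- a * t)).

Definition C2 (R : realType) (f : R -> R) : Prop :=
  [/\ forall t, derivable f t 1, forall t, derivable (derive1 f) t 1 &
      continuous (derive1n 2 f)].

(* No normalization is imposed: the functions are determined up to nonzero
   factors, which may depend on a and j. *)
Definition hyperbolic_bsplines (R : realType) (m : nat) (xi1 h a : R)
    (B : 'I_m.+2 -> R -> R) : Prop :=
  [/\ forall j, C2 (B j),
      forall j t, B j t != 0 ->
        knot xi1 h (j%:Z - 2) <= t <= knot xi1 h (j%:Z + 2),
      forall j (i : int), exists2 f, exp_segment a f &
        forall t, knot xi1 h i <= t <= knot xi1 h (i + 1) -> B j t = f t &
      forall c : 'I_m.+2 -> R,
        (forall t, \sum_j c j * B j t = 0) -> forall j, c j = 0].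

Definition hp_spline (R : realType) m (B : 'I_m.+2 -> R -> R)
    (c : 'rV[R]_m.+2) (t : R) : R :=
  \sum_j c 0 j * B j t.

Definition hp_objective (R : realType) d m (h lambda a : R)
    (B : 'I_m.+2 -> R -> R) (t : 'I_d -> R) (y : 'rV[R]_d) (c : 'rV[R]_m.+2)
    : R :=
  \sum_(i < d) (y 0 i - hp_spline B c (t i)) ^+ 2 +
  lambda ^+ 2 * \sum_(2 <= j < m.+2)
    (c 0 (inord j) - 2 * expR (- a * h) * c 0 (inord j.-1)
       + expR (- 2 * a * h) * c 0 (inord j.-2)) ^+ 2.

Definition hp_coefficients (R : realType) d m (h lambda a : R)
    (B : 'I_m.+2 -> R -> R) (t : 'I_d -> R) (y : 'rV[R]_d) (c : 'rV[R]_m.+2)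
    : Prop :=
  forall c', hp_objective h lambda a B t y c <= hp_objective h lambda a B t y c'.

Definition sup_dist (R : realType) (f g : R -> R) : \bar R :=
  'N[@lebesgue_measure R]_(+oo)[EFin \o (f \- g)].

(* alpha is regular off a finite set E of singular points; for an S that is
   not open, the Sobolev condition bears on the interior of S `\` E. *)
Definition regular_parameter (R : realType) d (k : nat) (S E : set 'rV[R]_d)
    (alpha : 'rV[R]_d -> R) : Prop :=
  [/\ finite_set E, E `<=` S, sobolev_Winfty k (S `\` E)° alpha &
      (sobolev_norm k (S `\` E)° alpha <= 1)%E].

(* In the two conditions below, shp s a is the HP-spline of frequency a fitted
   to s.  Ehp is a set of pairs (s, a), so that both exceptional samples and
   exceptional frequencies are allowed. *)
Definition locally_lipschitz_spline (R : realType) d N (S E : set 'rV[R]_d)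
    (shp : 'rV[R]_d -> R -> R -> R) (Reg : 'I_N.+1 -> set 'rV[R]_d)
    (Ehp : set ('rV[R]_d * R)) (L : 'I_N.+1 -> R) (Lhp : R) : Prop :=
  (forall i, Reg i `<=` S `\` E /\
     forall s a0, Reg i s -> ~ Ehp (s, a0) ->
       exists2 e : R, 0 < e & forall a a', `|a - a0| < e -> `|a' - a0| < e ->
         (sup_dist (shp s a) (shp s a') <= (L i * `|a - a'|)%:E)%E) /\
  Lhp = \big[Num.max/L ord0]_(i < N.+1) L i.

Definition flat_ranges (R : realType) d (S : set 'rV[R]_d)
    (shp : 'rV[R]_d -> R -> R -> R) (Lflat Lhp : R) : Prop :=
  Lflat < Lhp /\
  forall s, S s -> exists a b : R, a < b /\
    forall a1 a2, a <= a1 <= b -> a <= a2 <= b ->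
      (sup_dist (shp s a1) (shp s a2) <= (Lflat * `|a1 - a2|)%:E)%E.

(* Main.v *)
(* Splitting through the coefficients of s' at the frequency F s shows that
   s |-> coef s (F s) is Lipschitz with constant Ls + La * LF; it remains to
   bound the norm of s - s' by the diameter. *)
Require Import Defs.
From mathcomp Require Import all_boot all_order all_algebra.
From mathcomp Require Import all_classical all_reals all_analysis.

Set Implicit Arguments.
Unset Strict Implicit.
Unset Printing Implicit Defensive.

Import Order.TTheory GRing.Theory Num.Theory.
Import numFieldNormedType.Exports.

Local Open Scope classical_set_scope.
Local Open Scope ring_scope.

(** [0 = N (x - x) <= N x + N (- x) = 2 N x], where [N 0 = 0] and [N (- x) = N x] both come from
    homogeneity. *)
Lemma is_norm_ge0 (R : realType) (V : lmodType R) (N : V -> R) :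
  is_norm N -> forall x, 0 <= N x.
Proof.
case=> ND NZ _ x.
have := ND x ((-1) *: x).
rewrite NZ normrN1 mul1r scaleN1r subrr -[X in N X](scale0r 0) NZ normr0 mul0r.
by rewrite -mulr2n pmulrn_lge0.
Qed.

Lemma norm_le_diameter (R : realType) (V : lmodType R) (N : V -> R) (S : set V)
    x y :
  S x -> S y -> ((N (x - y))%:E <= diameter N S)%E.
Proof. by move=> Sx Sy; apply: ereal_sup_ubound; exists (x, y). Qed.

(* K may be negative: since f >= 0, the norm then vanishes on all differences
   and both sides are 0. *)
Lemma lipschitz_le_diameter (R : realType) (V : lmodType R) (N : V -> R)
    (S : set V) (f : V -> V -> R) (K : R) :
  is_norm N ->
  (forall x y, S x -> S y -> 0 <= f x y <= K * N (x - y)) ->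
  forall x y, S x -> S y -> ((f x y)%:E <= K%:E * diameter N S)%E.
Proof.
move=> normN fK x y Sx Sy; have /andP[_ fle] := fK x y Sx Sy.
have [K_ge0|K_lt0] := leP 0 K.
  (* The diameter may be [+oo]. If moreover [K = 0], the right-hand side is [0 * +oo = 0], which
     still bounds [K * N (x - y) = 0]. *)
  apply: (@le_trans _ _ (K%:E * (N (x - y))%:E)%E); first by rewrite -EFinM lee_fin.
  by apply: lee_wpmul2l; [rewrite lee_fin|exact: norm_le_diameter].
have N0 u v : S u -> S v -> N (u - v) = 0.
  move=> Su Sv; apply/eqP; rewrite eq_le is_norm_ge0// andbT.
  have /andP[f_ge0 /(le_trans f_ge0)] := fK u v Su Sv.
  by rewrite nmulr_rge0.
have -> : diameter N S = 0%E.
  apply/eqP; rewrite eq_le; apply/andP; split.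
    by apply: ge_ereal_sup => _ [[u v] [/= Su Sv] <-]; rewrite N0.
  (* The points [x] and [y] make [S] nonempty; the supremum over an empty set would be [-oo]. *)
  by have := norm_le_diameter N Sx Sy; rewrite N0.
by rewrite mule0 lee_fin; move: fle; rewrite (N0 x y)// mulr0.
Qed.

Theorem proposition2 (R : realType) (d m n k N : nat)
    (normS : 'rV[R]_d -> R) (normC : 'rV[R]_m.+2 -> R)
    (hnormS : is_norm normS) (hnormC : is_norm normC)
    (S : set 'rV[R]_d)
    (alpha : 'rV[R]_d -> R)
    (T : n.-tuple ('rV[R]_d * R))
    (hT : forall i : 'I_n,
        S (tnth T i).1 /\ (tnth T i).2 = alpha (tnth T i).1)
    (train : n.-tuple ('rV[R]_d * R) -> relu_net R d)
    (xi1 h lambda : R) (hh : 0 < h) (hlambda : 0 < lambda)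
    (t : 'I_d -> R)
    (B : R -> 'I_m.+2 -> R -> R)
    (hB : forall a, hyperbolic_bsplines xi1 h a (B a))
    (coef : 'rV[R]_d -> R -> 'rV[R]_m.+2)
    (hcoef : forall s a, S s ->
        hp_coefficients h lambda a (B a) t s (coef s a))
    (E : set 'rV[R]_d) (Reg : 'I_N.+1 -> set 'rV[R]_d)
    (Ehp : set ('rV[R]_d * R)) (Lhpi : 'I_N.+1 -> R) (Lhp Lflat : R)
    (hA1 : regular_parameter k S E alpha)
    (hA2 : locally_lipschitz_spline S E
             (fun s a => hp_spline (B a) (coef s a)) Reg Ehp Lhpi Lhp)
    (hA3 : flat_ranges S
             (fun s a => hp_spline (B a) (coef s a)) Lflat Lhp)
    (F : 'rV[R]_d -> R) (hF : F = net_eval (train T))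
    (LF Ls La : R)
    (hLF : forall s s', S s -> S s' -> `|F s - F s'| <= LF * normS (s - s'))
    (hLs : forall a s s', S s -> S s' ->
        normC (coef s a - coef s' a) <= Ls * normS (s - s'))
    (hLa : forall s a a', S s ->
        normC (coef s a - coef s a') <= La * `|a - a'|) :
  forall s s', S s -> S s' ->
    ((normC (coef s (F s) - coef s' (F s')))%:E
       <= (Ls + La * LF)%:E * diameter normS S)%E.
Proof.
(* No sign is assumed on [Ls] or [LF]: if [S] is a single point they can be negative, hence the
   lemma for an arbitrary real [K]. *)
apply: (lipschitz_le_diameter
  (f := fun s s' => normC (coef s (F s) - coef s' (F s')))) => // s s' Ss Ss'.
rewrite is_norm_ge0//=.
(* The frequencies 0 and 1 lie at distance 1, so [La] bounds a norm. Its sign allows the bound on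
   [F] to be multiplied by [La] at the end. *)
have La_ge0 : 0 <= La.
  have := le_trans (is_norm_ge0 hnormC _) (hLa s 0 1 Ss).
  by rewrite sub0r normrN1 mulr1.
have [normCD _ _] := hnormC.
rewrite -(subrKA (coef s' (F s))) mulrDl -mulrA.
apply: le_trans (normCD _ _) _; apply: lerD; first exact: hLs.
by apply: le_trans (hLa _ _ _ Ss') _; rewrite ler_wpM2l// hLF.
Qed.
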